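(* For $V,W\in \mathrm{Gr}(n)$, $$d_{\mathrm{FS}}(V,W)=\Theta_{V,W},\qquad d_{\mathrm{c\wedge}}(V,W)=2\sin\frac{\Theta_{V,W}}{2},\qquad d_{\mathrm{BC}}(V,W)=\sin\Theta_{V,W}.$$
   Context: $\mathbb{F}=\mathbb{R}$ or $\mathbb{C}$, $\mathbb{F}^n$ has its canonical inner product (Hermitian if $\mathbb{F}=\mathbb{C}$), and $\mathrm{Gr}(n)$ is the set of all subspaces of $\mathbb{F}^n$; $V_{(p)}$ indicates $\dim V=p$. Principal angles of $V_{(p)},W_{(q)}$ with $m=\min\{p,q\}\neq0$: $0\leq\theta_1\leq\cdots\leq\theta_m\leq\frac\pi2$, $\theta_i=\cos^{-1}\sigma_i$, where $\sigma_1\geq\cdots\geq\sigma_m$ are the singular values of the orthogonal projection $V\to W$. Asymmetric $\wedge$ metrics, for $V_{(p)},W_{(q)}$: all are $0$ if $p=0$. If $0<p\leq q$, $d_{\mathrm{FS}}(V,W)=\cos^{-1}(\prod_{i=1}^p\cos\theta_i)$, $d_{\mathrm{c\wedge}}(V,W)=\sqrt{2-2\prod_{i=1}^p\cos\theta_i}$, $d_{\mathrm{BC}}(V,W)=\sqrt{1-\prod_{i=1}^p\cos^2\theta_i}$. If $p>q$, they are respectively $\frac\pi2$, $\sqrt2$ and $1$. Asymmetric angle: for $V\in \mathrm{Gr}_p(\mathbb{F}^n)$ and $W\in \mathrm{Gr}_q(\mathbb{F}^n)$, $\Theta_{V,W}=\cos^{-1}\frac{\|P_WA\|}{\|A\|}$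 for any nonzero $A\in\bigwedge^pV$ (a one-dimensional space). Here $\bigwedge^pV$ is the $p$-th exterior power of $V$ ($\bigwedge^0V=\mathbb{F}$), $\bigwedge\mathbb{F}^n$ has the inner product given by $\langle v_1\wedge\cdots\wedge v_p,w_1\wedge\cdots\wedge w_p\rangle=\det(\langle v_i,w_j\rangle)$ (with different exterior powers orthogonal, and $\langle\kappa,\lambda\rangle=\bar\kappa\lambda$ for scalars), and $P_W:\bigwedge\mathbb{F}^n\to\bigwedge W$ is the orthogonal projection, which satisfies $P_W(v_1\wedge\cdots\wedge v_p)=P_Wv_1\wedge\cdots\wedge P_Wv_p$ and $P_W\lambda=\lambda$ for $\lambda\in\mathbb{F}$. *)

(* Defs.v *)
From HB Require Import structures.
From mathcomp Require Import all_boot all_order all_fingroup all_algebra.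
From mathcomp Require Import boolp classical_sets reals trigo.
From mathcomp Require Import complex.

Set Implicit Arguments.
Unset Strict Implicit.
Unset Printing Implicit Defensive.

Import Order.TTheory GRing.Theory Num.Theory.
Local Open Scope ring_scope.
Local Open Scope sesquilinear_scope.

(* The field F is either R or C = R[i]. *)
Variant scalar_kind := RealScalars | ComplexScalars.

Definition scalar_field (R : realType) (k : scalar_kind) : numFieldType :=
  match k with
  | RealScalars => (R : numFieldType)
  | ComplexScalars => (R[i] : numFieldType)
  end.

Definition scalar_conj (R : realType) (k : scalar_kind) :
    involutive_rmorphism (scalar_field R k) :=
  match k with
  | RealScalars => (idfun : involutive_rmorphism R)
  | ComplexScalars => (@Num.conj R[i] : involutive_rmorphism R[i])
  end.

Definition real_part (R : realType) (k : scalar_kind) : scalar_field R k -> R :=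
  match k with
  | RealScalars => idfun
  | ComplexScalars => @complex.Re R
  end.

Section InnerProduct.
Context {R : realType} {k : scalar_kind}.
Local Notation F := (scalar_field R k).

Lemma mul_conj_ge0 (x : F) : 0 <= x * scalar_conj R k x.
Proof. by case: k x => x; [exact: sqr_ge0 | exact: mul_conjC_ge0]. Qed.

Lemma mul_conj_gt0 (x : F) : (0 < x * scalar_conj R k x) = (x != 0).
Proof.
by rewrite lt0r mul_conj_ge0 andbT mulf_eq0 fmorph_eq0 orbb.
Qed.

Fact one_hermitian n : (1%:M : 'M[F]_n) \is hermitianmx n false (scalar_conj R k).
Proof. by apply/is_hermitianmxP; rewrite expr0 scale1r trmx1 map_mx1. Qed.

Definition one_hermmx n := HermitianMx (one_hermitian n).

(* The library's forms are linear in the first argument and conjugate-linear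
   in the second: for the inner product <u, v> = \sum_i conj(u_i) v_i, which is
   conjugate-linear in the first argument, [dot v u] is <u, v>. *)
Definition dot n (u v : 'rV[F]_n) : F :=
  form_of_matrix (scalar_conj R k) (one_hermmx n) u v.

HB.instance Definition _ n := Bilinear.copy (@dot n)
  (form_of_matrix (scalar_conj R k) (one_hermmx n)).
HB.instance Definition _ n := Hermitian.copy (@dot n)
  (form_of_matrix (scalar_conj R k) (one_hermmx n)).

Lemma dotE n (u v : 'rV[F]_n) : dot u v = \sum_i u 0 i * scalar_conj R k (v 0 i).
Proof.
rewrite /dot /form_of_matrix mulmx1 trace_mx11 !mxE.
by apply: eq_bigr => i _; rewrite !mxE.
Qed.

Fact dot_gt0 n (u : 'rV[F]_n) : u != 0 -> 0 < dot u u.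
Proof.
move=> u0; rewrite dotE.
have /existsP[i ui] : [exists i, u 0 i != 0].
  apply: contraNT u0; rewrite negb_exists => /forallP H.
  by apply/eqP/rowP => j; rewrite mxE; apply/eqP; rewrite -[_ == _]negbK H.
rewrite (bigD1 i)//= ltr_wpDr ?mul_conj_gt0//.
by apply: sumr_ge0 => j _; exact: mul_conj_ge0.
Qed.

HB.instance Definition _ n := isDotProduct.Build _ _ (@dot n) (@dot_gt0 n).

Definition vnorm n (u : 'rV[F]_n) : R := Num.sqrt (real_part (dot u u)).

Definition proj_orth n (U : {vspace 'rV[F]_n}) : 'End('rV[F]_n) :=
  daddv_pi U (orthov (@dot n) U).

Definition is_onb n (U : {vspace 'rV[F]_n}) (e : (\dim U).-tuple 'rV[F]_n) :=
  basis_of U e && orthonormal (@dot n) e.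

Definition onb n (U : {vspace 'rV[F]_n}) : (\dim U).-tuple 'rV[F]_n :=
  xget (vbasis U) [set e | is_onb e].

End InnerProduct.

Section SingularValues.
Context {R : realType} {k : scalar_kind}.
Local Notation F := (scalar_field R k).

(* With multiplicity; [eigenvaluesP] below shows that the default value is not
   reached for the matrices N^* N used here.  The order is irrelevant, since
   [singular_values] sorts the list. *)
Definition eigenvalues p (M : 'M[F]_p) : seq F :=
  xget [::] [set s | char_poly M = \prod_(z <- s) ('X - z%:P)].

(* The min(p, q) largest square roots of eigenvalues of M^* M, in decreasing
   order. *)
Definition singular_values q p (M : 'M[F]_(q, p)) : seq R :=
  take (minn p q)
    (sort >=%R [seq Num.sqrt (real_part z) |
                  z <- eigenvalues (M ^t (scalar_conj R k) *m M)]).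

(* Matrix of the orthogonal projection V -> W in orthonormal bases of V and W,
   acting on columns of coordinates.  Other orthonormal bases multiply it by
   unitary matrices, which does not change its singular values. *)
Definition proj_mx_onb n (V W : {vspace 'rV[F]_n}) : 'M[F]_(\dim W, \dim V) :=
  \matrix_(i, j) dot (proj_orth W (onb V)`_j) (onb W)`_i.

Definition principal_angles n (V W : {vspace 'rV[F]_n}) : seq R :=
  [seq acos s | s <- singular_values (proj_mx_onb V W)].

End SingularValues.

Section Metrics.
Context {R : realType} {k : scalar_kind} {n : nat}.
Implicit Types V W : {vspace 'rV[scalar_field R k]_n}.

Definition d_FS V W : R :=
  if \dim V == 0 then 0
  else if (\dim V <= \dim W)%N then
    acos (\prod_(i < \dim V) cos (principal_angles V W)`_i)
  else pi / 2.

Definition d_chordal_wedge V W : R :=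
  if \dim V == 0 then 0
  else if (\dim V <= \dim W)%N then
    Num.sqrt (2 - 2 * \prod_(i < \dim V) cos (principal_angles V W)`_i)
  else Num.sqrt 2.

Definition d_BC V W : R :=
  if \dim V == 0 then 0
  else if (\dim V <= \dim W)%N then
    Num.sqrt (1 - \prod_(i < \dim V) cos (principal_angles V W)`_i ^+ 2)
  else 1.

End Metrics.

Section ExteriorAlgebra.
Context {R : realType} {k : scalar_kind} {n : nat}.
Local Notation F := (scalar_field R k).

(* The exterior algebra of F^n in coordinates with respect to the orthonormal
   basis e_I = e_i1 /\ ... /\ e_ip, for I = {i1 < ... < ip} a subset of 'I_n.
   Its inner product is thus again [dot]; [dot_wedge] and [dot_wedge_neq] give
   its values on decomposable vectors. *)
Definition ext_alg := 'rV[F]_#|{set 'I_n}|.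

(* [enum I] lists I in increasing order. *)
Definition minor_on p (A : 'M[F]_(p, n)) (I : {set 'I_n}) : F :=
  \det (\matrix_(i < p, j < p) [seq A i x | x <- enum I]`_j).

(* The wedge product of the p rows of A. *)
Definition wedge p (A : 'M[F]_(p, n)) : ext_alg :=
  \row_(l < #|{set 'I_n}|)
    let I : {set 'I_n} := enum_val l in if #|I| == p then minor_on A I else 0.

(* The p-th exterior power of V; it contains the wedge of any p vectors of V, see
   [mem_ext_pow]. *)
Definition ext_pow p (V : {vspace 'rV[F]_n}) : {vspace ext_alg} :=
  <<[seq wedge (\matrix_(i < p) (vbasis V)`_(f i))
       | f : {ffun 'I_p -> 'I_(\dim V)}]>>%VS.

(* The exterior algebra of W, as a subspace of that of F^n. *)
Definition ext_sub (W : {vspace 'rV[F]_n}) : {vspace ext_alg} :=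
  (\sum_(p < n.+1) ext_pow p W)%VS.

Definition angle_at (W : {vspace 'rV[F]_n}) (A : ext_alg) : R :=
  acos (vnorm (proj_orth (ext_sub W) A) / vnorm A).

(* Any nonzero element of the line [ext_pow (\dim V) V] gives the same value:
   see [dim_ext_pow] and [asym_angleE]. *)
Definition asym_angle (V W : {vspace 'rV[F]_n}) : R :=
  angle_at W (vpick (ext_pow (\dim V) V)).

End ExteriorAlgebra.

Section WellDefinedness.
Context {R : realType} {k : scalar_kind}.
Local Notation F := (scalar_field R k).

Lemma unit_scale (x : F) : 0 < x -> exists c : F, c * scalar_conj R k c * x = 1.
Proof.
case: k x => /= x x0.
  exists (Num.sqrt x)^-1; rewrite -invfM -expr2 sqr_sqrtr ?ltW//.
  by rewrite mulVf ?gt_eqF.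
exists (sqrtC x)^-1; have s0 : 0 <= (sqrtC x)^-1 by rewrite invr_ge0 sqrtC_ge0 ltW.
by rewrite (CrealP (ger0_real s0)) -invfM -expr2 sqrtCK mulVf ?gt_eqF.
Qed.

Lemma basis_size n (U : {vspace 'rV[F]_n}) s : basis_of U s -> size s = \dim U.
Proof. by case/andP => /eqP <- /eqP. Qed.

Lemma onb_exists n (U : {vspace 'rV[F]_n}) :
  exists s, basis_of U s && orthonormal (@dot R k n) s.
Proof.
have [d] := ubnP (\dim U); elim: d U => // d IH U; rewrite ltnS => dU.
have [->|U0] := eqVneq U 0%VS.
  by exists [::]; rewrite basisEdim sub0v dimv0.
set u := vpick U; have uU : u \in U := memv_pick U.
have u0 : u != 0 by rewrite vpick0.
have uN : u \notin orthov (@dot R k n) U.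
  by apply/mem_orthovPn; exists u => //; rewrite gt_eqF// dot_gt0.
have dU0 : (0 < \dim U)%N by rewrite lt0n dimv_eq0.
have dU' := eq_dim_orthov1 uN.
set U' := (U :&: _)%VS in dU'.
have [|s /andP[bs os]] := IH U'.
  by rewrite -dU' -ltnS prednK.
have [c cu] := unit_scale (dot_gt0 u0).
have c0 : c != 0 by apply: contra_eq_neq cu => ->; rewrite !mul0r eq_sym oner_neq0.
have dcu : dot (c *: u) (c *: u) = 1.
  by rewrite linearZl_LR linearZr_LR/= mulrA.
have sU' : {subset s <= U'} by move=> x xs; apply: (basis_mem bs xs).
exists (c *: u :: s); apply/andP; split; last first.
  move: os; rewrite /orthonormal /= dcu eqxx/= => /andP[-> ->]; rewrite !andbT.
  apply/allP => x /sU' /=; rewrite memv_cap => /andP[_].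
  rewrite mem_orthov1 herm_eq0C => /eqP uv.
  by rewrite linearZl_LR/= uv mulr0.
rewrite basisEdim/= (basis_size bs) -dU' prednK// leqnn andbT.
apply/subvP => w wU; rewrite span_cons.
rewrite -[w](subrKC (dot w (c *: u) *: (c *: u))) memv_add//.
  by rewrite memvZ// memv_line.
rewrite (eqP (proj1 (andP bs))) memv_cap rpredB ?rpredZ//=.
rewrite mem_orthov1.
apply/eqP; have : dot (w - dot w (c *: u) *: (c *: u)) (c *: u) = 0.
  by rewrite linearBl/= linearZl_LR/= dcu mulr1 subrr.
rewrite linearZr_LR/= => /eqP; rewrite mulf_eq0 fmorph_eq0 (negPf c0)/=.
by move/eqP.
Qed.

Lemma onbP n (U : {vspace 'rV[F]_n}) : is_onb (onb U).
Proof.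
have [s /andP[bs os]] := onb_exists U.
have sz : size s == \dim U by rewrite (basis_size bs).
rewrite /onb; case: xgetP => // /(_ (Tuple sz)) [].
by rewrite /is_onb /= bs os.
Qed.

Lemma orth_split n (s : seq 'rV[F]_n) v : orthonormal (@dot R k n) s ->
  exists2 p, p \in <<s>>%VS & {in s, forall y, dot (v - p) y = 0}.
Proof.
elim: s => [|x s IH]; first by exists 0; rewrite ?mem0v.
rewrite /orthonormal/= andbT -andbA => /and4P[/eqP xx os xs ps].
have [|p ps' hp] := IH; first exact/andP.
have sx : (<<s>> <= orthov (@dot R k n) <[x]>)%VS.
  apply/span_subvP => y ys; rewrite mem_orthov1 herm_eq0C.
  by move/allP: xs => /(_ _ ys).
exists (dot v x *: x + p).
  by rewrite span_cons memv_add// memvZ// memv_line.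
have px : dot p x = 0 by apply/eqP; rewrite -mem_orthov1 (subvP sx).
move=> y; rewrite inE => /orP[/eqP ->|ys].
  by rewrite linearBl/= linearDl/= linearZl_LR/= xx mulr1 px addr0 subrr.
rewrite opprD addrCA linearDl/= (hp _ ys) addr0 linearNl linearZl_LR/=.
by move/allP: xs => /(_ _ ys)/eqP ->; rewrite mulr0 oppr0.
Qed.

Lemma proj_orthP n (U : {vspace 'rV[F]_n}) v :
  (proj_orth U v \in U) && (v - proj_orth U v \in orthov (@dot R k n) U).
Proof.
rewrite /proj_orth memv_pi /=.
have [s /andP[bs os]] := onb_exists U.
have dis : (U :&: orthov (@dot R k n) U = 0)%VS.
  apply/eqP; rewrite -subv0; apply/subvP => x; rewrite memv_cap memv0 => /andP[xU].
  by move/mem_orthovP => /(_ _ xU) /eqP; apply: contraLR => x0;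
  by rewrite gt_eqF// dot_gt0.
have vUU : v \in (U + orthov (@dot R k n) U)%VS.
  have [p ps hp] := orth_split v os.
  rewrite -[v](subrKC p) memv_add//; first by rewrite -(eqP (proj1 (andP bs))).
  rewrite -(eqP (proj1 (andP bs))) mem_orthov_sym; apply/span_subvP => y ys.
  by rewrite mem_orthov1 herm_eq0C; apply/eqP/hp.
rewrite (_ : v - _ = daddv_pi (orthov (@dot R k n) U) U v) ?memv_pi//.
by apply/eqP; rewrite subr_eq addrC daddv_pi_add.
Qed.

Lemma cauchy_binet p n (A B : 'M[F]_(p, n)) :
  \det (A *m B^T) = \sum_(I : {set 'I_n} | #|I| == p) minor_on A I * minor_on B I.
Proof.
have minorE (D : 'M[F]_(p, n)) (I : {set 'I_n}) (cI : #|I| = p) :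
    minor_on D I = \det (\matrix_(i, j) D i (enum_val (cast_ord (esym cI) j))).
  subst p; congr (\det _); apply/matrixP => i j; rewrite !mxE cast_ord_id.
  have x := enum_val j.
  by rewrite (nth_map x) -?cardE// -enum_val_nth.
transitivity (\sum_(f : {ffun 'I_p -> 'I_n})
    (\prod_i A i (f i)) * \det (\matrix_(i, j) B j (f i))).
  rewrite /determinant.
  under eq_bigr => s _.
    under eq_bigr => i _ do rewrite mxE.
    rewrite bigA_distr_bigA /= big_distrr /=. over.
  rewrite exchange_big; apply: eq_bigr => f _ /=.
  rewrite big_distrr /=; apply: eq_bigr => s _.
  rewrite mulrCA; congr (_ * _); rewrite -big_split /=.
  by apply: eq_bigr => i _; rewrite !mxE.
rewrite (bigID (fun f : {ffun 'I_p -> 'I_n} => injectiveb f)) /= [X in _ + X]big1 ?addr0; last first.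
  move=> f /injectivePn[i [j ij fij]].
  rewrite (determinant_alternate (i1 := i) (i2 := j)) ?mulr0// => l.
  by rewrite !mxE fij.
rewrite (partition_big (fun f : {ffun 'I_p -> 'I_n} => [set f i | i in 'I_p]%SET)
   (fun I : {set 'I_n} => #|I| == p)) /=; last first.
  by move=> f /injectiveP fi; rewrite card_imset// card_ord.
apply: eq_bigr => I /eqP cI.
rewrite !(minorE _ _ cI).
pose e j := enum_val (cast_ord (esym cI) j).
have ei : injective e by move=> x y /enum_val_inj/cast_ord_inj.
pose ef (s : 'S_p) := [ffun i => e (s i)].
rewrite (reindex_onto ef (fun f => odflt 1%g [pick s | ef s == f])) /=; last first.
  move=> f /andP[/injectiveP fi /eqP fI].
  case: pickP => [s /eqP //|/=] none.
  have ex i : {j | e j == f i}.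
    apply: sigW; have : f i \in I by rewrite -fI imset_f.
    move=> fiI; exists (cast_ord cI (enum_rank_in fiI (f i))).
    by rewrite /e cast_ordK enum_rankK_in.
  pose h i := projT1 (ex i).
  have hE i : e (h i) = f i by rewrite /h; case: (ex i) => j /= /eqP.
  have hi : injective h by move=> x y /(congr1 e); rewrite !hE => /fi.
  have := none (perm hi); suff -> : ef (perm hi) = f by rewrite eqxx.
  by apply/ffunP => i; rewrite ffunE permE hE.
rewrite (eq_bigl xpredT); last first.
  move=> s /=; rewrite -andbA; apply/and3P; split.
  - by apply/injectiveP => x y; rewrite !ffunE => /ei/perm_inj.
  - have -> : I = [set e i | i in 'I_p]%SET.
      apply/esym/eqP; rewrite eqEcard card_imset// card_ord cI leqnn andbT.
      by apply/fintype.subsetP => x /imsetP[j _ ->]; exact: enum_valP.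
    apply/eqP/setP => x; apply/imsetP/imsetP => [[j _ ->]|[j _ ->]].
      by exists (s j); rewrite // ffunE.
    by exists (s^-1 j)%g; rewrite // ffunE permKV.
  - case: pickP => [t /eqP ts|/(_ s)]; last by rewrite eqxx.
    apply/eqP/permP => i; have /ffunP/(_ i) := ts.
    by rewrite !ffunE => /ei.
rewrite big_distrl /=; apply: eq_bigr => s _.
rewrite -!/(e _).
have -> : \det (\matrix_(i, j) B j (ef s i)) = (-1) ^+ s * \det (\matrix_(i, j) B i (e j)).
  rewrite -[\det (\matrix_(i, j) B i (e j))]det_tr -det_perm -det_mulmx; congr (\det _).
  apply/matrixP => i j; rewrite -row_permE !mxE ffunE //.
rewrite mulrA mulrC [RHS]mulrC; congr (_ * _).
rewrite mulrC; congr (_ * _).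
by apply: eq_bigr => i _; rewrite ffunE mxE.
Qed.

Lemma dot_wedge p n (A B : 'M[F]_(p, n)) :
  dot (wedge A) (wedge B) = \det (\matrix_(i, j) dot (row i A) (row j B)).
Proof.
have -> : \matrix_(i, j) dot (row i A) (row j B) = A *m (map_mx (scalar_conj R k) B)^T.
  apply/matrixP => i j; rewrite !mxE dotE; apply: eq_bigr => l _.
  by rewrite !mxE.
rewrite cauchy_binet dotE (reindex_onto (@enum_rank _) (@enum_val _ _)) /=; last first.
  by move=> i _; rewrite enum_valK.
rewrite (eq_bigl xpredT) => [|I]; last by rewrite enum_rankK eqxx.
rewrite [RHS]big_mkcond; apply: eq_bigr => I _; rewrite !mxE enum_rankK.
rewrite /=; case: eqP => _; last by rewrite mul0r.
congr (_ * _); rewrite /minor_on -det_map_mx; congr (\det _).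
apply/matrixP => i j; rewrite !mxE.
have [jI|jI] := leqP (size (enum I)) j.
  by rewrite !nth_default ?size_map// rmorph0.
have x : 'I_n by case: (enum I) jI.
by rewrite !(nth_map x)// mxE.
Qed.

Lemma wedge_mul p n (P : 'M[F]_p) (B : 'M[F]_(p, n)) :
  wedge (P *m B) = \det P *: wedge B.
Proof.
apply/rowP => l; rewrite !mxE /=; case: eqP => [cI|]; last by rewrite mulr0.
rewrite /minor_on -det_mulmx; congr (\det _); apply/matrixP => i j.
have jI : (j < size (enum (enum_val l)))%N by rewrite -cardE cI.
have x : 'I_n by case: (enum _) jI.
rewrite !mxE (nth_map x)// mxE; apply: eq_bigr => m _.
by rewrite mxE (nth_map x).
Qed.

Lemma ext_pow_wedge n (V : {vspace 'rV[F]_n}) (p := \dim V) :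
  ext_pow p V = <[wedge (\matrix_(i < p) (vbasis V)`_i)]>%VS.
Proof.
apply/eqP; rewrite eqEsubv; apply/andP; split.
  apply/span_subvP => _ /mapP[f _ ->].
  have -> : \matrix_(i < p) (vbasis V)`_(f i) =
      (\matrix_(i, j) (j == f i)%:R) *m (\matrix_(i < p) (vbasis V)`_i).
    apply/matrixP => i j; rewrite !mxE (bigD1 (f i))//= !mxE eqxx mul1r.
    by rewrite big1 ?addr0// => l lf; rewrite mxE (negPf lf) mul0r.
  by rewrite wedge_mul memvZ// memv_line.
rewrite -memvE; apply: memv_span; apply/mapP; exists [ffun i => i]; rewrite ?mem_enum//.
by congr wedge; apply/matrixP => i j; rewrite !mxE ffunE.
Qed.

Lemma mem_ext_pow n p (V : {vspace 'rV[F]_n}) (A : 'M[F]_(p, n)) :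
  (forall i, row i A \in V) -> wedge A \in ext_pow p V.
Proof.
move=> AV.
have AE i j : A i j = \sum_l coord (vbasis V) l (row i A) * (vbasis V)`_l 0 j.
  have /rowP/(_ j) := coord_vbasis (AV i); rewrite mxE summxE => ->.
  by apply: eq_bigr => l _; rewrite mxE.
have -> : wedge A = \sum_(f : {ffun 'I_p -> 'I_(\dim V)})
    (\prod_i coord (vbasis V) (f i) (row i A)) *:
    wedge (\matrix_(i < p) (vbasis V)`_(f i)).
  apply/rowP => l; rewrite summxE !mxE /=.
  under eq_bigr do rewrite !mxE /=.
  case: eqP => [cI|]; last by rewrite big1// => f _; rewrite mulr0.
  rewrite /minor_on {1}/determinant.
  under [RHS]eq_bigr do rewrite /determinant big_distrr /=.
  rewrite exchange_big; apply: eq_bigr => s _ /=.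
  under [RHS]eq_bigr do rewrite mulrCA.
  rewrite -big_distrr /=; congr (_ * _).
  under [RHS]eq_bigr do rewrite -big_split /=.
  transitivity (\prod_i \sum_m coord (vbasis V) m (row i A) *
      [seq (vbasis V)`_m 0 x | x <- enum (enum_val l)]`_(s i)); last first.
    rewrite bigA_distr_bigA /=; apply: eq_bigr => f _; apply: eq_bigr => i _.
    rewrite mxE; congr (_ * nth 0 _ _).
    by apply: eq_map => x; rewrite mxE.
  apply: eq_bigr => i _; rewrite mxE.
  have jI : (s i < size (enum (enum_val l)))%N by rewrite -cardE cI.
  have x : 'I_n by case: (enum _) jI.
  rewrite (nth_map x)// AE; apply: eq_bigr => m _.
  by rewrite (nth_map x).
apply: memv_suml => f _; apply: memvZ; apply: memv_span.
by apply/mapP; exists f; rewrite ?mem_enum.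
Qed.

Lemma dot_wedge_neq p q n (A : 'M[F]_(p, n)) (B : 'M[F]_(q, n)) :
  p != q -> dot (wedge A) (wedge B) = 0.
Proof.
move=> pq; rewrite dotE big1// => l _; rewrite !mxE /=.
case: eqP => [-> |_]; last by rewrite mul0r.
by rewrite (negPf pq) rmorph0 mulr0.
Qed.

Lemma real_partZ (c x : F) : 0 <= x ->
  Num.sqrt (real_part (c * scalar_conj R k c * x)) =
  Num.sqrt (real_part (c * scalar_conj R k c)) * Num.sqrt (real_part x).
Proof.
move=> x0; have := mul_conj_ge0 c; move: (c * _) => y {c}.
case: k x x0 y => /= x x0 y y0; first by rewrite sqrtrM.
case: x x0 => a b; case: y y0 => a' b'; rewrite !lecE/= => /andP[/eqP -> y0].
by move=> /andP[/eqP -> x0]; rewrite mulr0 subr0 sqrtrM.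
Qed.

Lemma dot_ge0 n (u : 'rV[F]_n) : 0 <= dot u u.
Proof.
have [->|u0] := eqVneq u 0; last exact/ltW/dot_gt0.
by rewrite linear0r.
Qed.

Lemma dot_mxE n (u v : 'rV[F]_n) : dot u v = (u *m v ^t (scalar_conj R k)) 0 0.
Proof. by rewrite dotE mxE; apply: eq_bigr => i _; rewrite !mxE. Qed.

Lemma normZ n c (u : 'rV[F]_n) :
  vnorm (c *: u) = Num.sqrt (real_part (c * scalar_conj R k c)) * vnorm u.
Proof. by rewrite /vnorm linearZl_LR linearZr_LR/= mulrA real_partZ// dot_ge0. Qed.

Lemma orthonormal_nth n (s : seq 'rV[F]_n) i j : orthonormal (@dot R k n) s ->
  (i < size s)%N -> (j < size s)%N -> dot s`_i s`_j = (i == j)%:R.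
Proof.
elim: s i j => // x s IH i j.
rewrite /orthonormal/= andbT -andbA => /and4P[/eqP xx os /allP xs ps].
have os' : orthonormal (@dot R k n) s by apply/andP.
case: i j => [|i] [|j] //=; rewrite ?ltnS => hi hj.
- by apply/eqP; exact: (xs _ (mem_nth 0 hj)).
- by apply/eqP; rewrite herm_eq0C; exact: (xs _ (mem_nth 0 hi)).
- by rewrite eqSS IH.
Qed.

Lemma onb_dot n (V : {vspace 'rV[F]_n}) (i j : 'I_(\dim V)) :
  dot (onb V)`_i (onb V)`_j = (i == j)%:R.
Proof. by have /andP[_ oe] := onbP V; rewrite orthonormal_nth// size_tuple. Qed.

Lemma dim_ext_pow n (V : {vspace 'rV[F]_n}) : \dim (ext_pow (\dim V) V) = 1%N.
Proof.
have /andP[be oe] := onbP V.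
pose E := \matrix_(i < \dim V) (onb V)`_i.
have EV : wedge E \in ext_pow (\dim V) V.
  by apply: mem_ext_pow => i; rewrite rowK (basis_mem be)// mem_nth// size_tuple.
move: EV; rewrite ext_pow_wedge => EV; rewrite dim_vline.
have : dot (wedge E) (wedge E) = 1.
  rewrite dot_wedge -[RHS](det1 F (\dim V)); congr (\det _).
  by apply/matrixP => i j; rewrite !mxE !rowK onb_dot.
case: eqVneq EV => // ->; rewrite memv0 => w0.
by rewrite (eqP w0) linear0r => /eqP; rewrite eq_sym oner_eq0.
Qed.

Lemma asym_angleE n (V W : {vspace 'rV[F]_n}) A :
  A \in ext_pow (\dim V) V -> A != 0 -> asym_angle V W = angle_at W A.
Proof.
rewrite /asym_angle => AV A0.
set B := vpick _; have BV : B \in ext_pow (\dim V) V := memv_pick _.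
have B0 : B != 0.
  rewrite /B vpick0; apply: contraNneq A0 => VV0.
  by move: AV; rewrite VV0 memv0.
move: AV BV; rewrite ext_pow_wedge => /vlineP[a Aa] /vlineP[b Bb].
have b0 : b != 0 by apply: contra_neq B0 => b0; rewrite Bb b0 scale0r.
have a0 : a != 0 by apply: contra_neq A0 => a0; rewrite Aa a0 scale0r.
rewrite Aa Bb /angle_at !linearZ /= !normZ.
have sqrt0 (c : F) : c != 0 -> Num.sqrt (real_part (c * scalar_conj R k c)) != 0.
  rewrite -mul_conj_gt0; case: k c => /= c c0; rewrite gt_eqF// sqrtr_gt0//.
  by move: c0; rewrite ltcE/= => /andP[].
by rewrite -!mulf_div !divff ?sqrt0// !mul1r.
Qed.

End WellDefinedness.

Lemma eigenvaluesP {R : realType} {k : scalar_kind} q p (N : 'M[scalar_field R k]_(q, p)) :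
  let G := N ^t (scalar_conj R k) *m N in
  char_poly G = \prod_(z <- eigenvalues G) ('X - z%:P).
Proof.
move=> G; rewrite /eigenvalues; case: xgetP => [y _ //|none].
exfalso; move: @G none; case: k N => N G none.
  pose c : {rmorphism R -> R[i]} := real_complex R.
  have [s] := closed_field_poly_normal (map_poly c (char_poly G)).
  rewrite (monicP _) ?monic_map ?char_poly_monic// scale1r => sE.
  have sR : {in s, forall z, c (complex.Re z) = z}.
    move=> z zs; have : root (map_poly c (char_poly G)) z by rewrite sE root_prod_XsubC.
    rewrite map_char_poly -eigenvalue_root_char => /eigenvalueP[v vz v0].
    have v1 : 0 < (v *m v ^t Num.conj) 0 0.
      by have := @dot_gt0 R ComplexScalars p v v0; rewrite (@dot_mxE R ComplexScalars).
    pose w := v *m map_mx c N^T.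
    have w1 : 0 <= (w *m w ^t Num.conj) 0 0.
      have := @dot_ge0 R ComplexScalars q w; rewrite (@dot_mxE R ComplexScalars); apply.
    have zv : z * (v *m v ^t Num.conj) 0 0 = (w *m w ^t Num.conj) 0 0.
      have -> : w ^t Num.conj = map_mx c N *m v ^t Num.conj.
        rewrite /w trmx_mul map_mxM; congr (_ *m _).
        by apply/matrixP => i j; rewrite !mxE /=; exact: conjc_real.
      rewrite /w mulmxA -[v *m _ *m _]mulmxA -map_mxM.
      rewrite (_ : N^T *m N = G); last first.
        by rewrite /G; congr (_ *m _); apply/matrixP => i j; rewrite !mxE.
      by rewrite vz -scalemxAl [RHS]mxE.
    have : 0 <= z by rewrite -(pmulr_lge0 z v1) zv.
    by case: z {zs vz zv} => a b; rewrite lecE /= => /andP[/eqP -> _].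
  apply: (none (map (@complex.Re R) s)); apply: (map_poly_inj c) => /=.
  rewrite sE big_map rmorph_prod /=; apply: eq_big_seq => z zs.
  by rewrite rmorphB /= map_polyX map_polyC /= sR.
have [s] := @closed_field_poly_normal R[i] (char_poly G).
rewrite (monicP (char_poly_monic _)) scale1r => sE.
exact: (none s).
Qed.

(* Main.v *)
Require Import Defs.
From mathcomp Require Import all_boot all_order all_algebra.
From mathcomp Require Import reals trigo.
From mathcomp Require Import complex.
Import GRing.Theory Num.Theory.
Local Open Scope ring_scope.

Set Implicit Arguments.
Unset Strict Implicit.
Unset Printing Implicit Defensive.
Import Order.TTheory.
Local Open Scope sesquilinear_scope.

(** Everything is a function of one number, the factor c by which orthogonal
projection to W shrinks the norm of a p-vector of V, where p = dim V; the
metrics and the asymmetric angle come from two ways of computing it.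

On the exterior side, let E be an orthonormal basis of V. Then wedge E is a
unit vector of the p-th exterior power of V, and its projection is the wedge of
the projections P e_i ([proj_orth_wedge]): projecting one factor of an inner
product det <v_i, w_j> changes nothing when all w_j lie in W. Hence
cos(Theta)^2 = ||P_W (wedge E)||^2 is the Gram determinant of the P e_i, that
is det (N^* N) for the matrix N of the projection V -> W ([asym_angle_det]).

On the metric side, the cosines of the principal angles are the singular values
of N, whose squares are the eigenvalues of N^* N; these lie in [0, 1] because
the projection is a contraction ([eigenvalues_proj_gram]), so that acos loses
nothing. If p <= dim W no eigenvalue is discarded, and the product of the
cosines is the square root of det (N^* N) ([prod_cos_principal_angles]). If
p > dim W, then N^* N is singular and c = 0, and if p = 0 the determinant is
empty and c = 1; these are the values that the definitions prescribe
separately.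

What remains is trigonometry: with theta = acos c, the chord is
sqrt (2 - 2 c) = 2 sin (theta / 2) and the sine is sqrt (1 - c^2). *)

(** * Real parts of scalars in the unit interval *)

Section RealPart.
Context {R : realType} {k : scalar_kind}.
Local Notation F := (scalar_field R k).

Lemma real_part1 : real_part (1 : F) = 1.
Proof. by case: k. Qed.

Lemma real_part0 : real_part (0 : F) = 0.
Proof. by case: k. Qed.

Lemma real_part_itv01 (x : F) : 0 <= x <= 1 -> 0 <= real_part x <= 1.
Proof.
case: k x => // -[a b]; rewrite !lecE /=.
by case/andP=> /andP[_ ->] /andP[_ ->].
Qed.

Lemma real_partM_ge0 (x y : F) : 0 <= x -> 0 <= y ->
  real_part (x * y) = real_part x * real_part y.
Proof.
case: k x y => // -[a b] [a' b']; rewrite !lecE /=.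
by move=> /andP[/eqP -> _] /andP[/eqP -> _]; rewrite mulr0 subr0.
Qed.

(** The real part is not multiplicative on complex numbers, but the order of the
scalar field forces numbers between 0 and 1 to be real. *)
Lemma sqrt_real_part_prod (s : seq F) : {in s, forall z, 0 <= z <= 1} ->
  Num.sqrt (real_part (\prod_(z <- s) z)) =
  \prod_(z <- s) Num.sqrt (real_part z).
Proof.
elim: s => [|x s IH] s01; first by rewrite !big_nil real_part1 sqrtr1.
have /andP[x0 x1] : 0 <= x <= 1 by apply: s01; rewrite mem_head.
have s01' : {in s, forall z, 0 <= z <= 1}.
  by move=> z zs; apply: s01; rewrite inE zs orbT.
rewrite !big_cons real_partM_ge0 ?sqrtrM ?IH //.
  by have /andP[] := real_part_itv01 (s01 x (mem_head _ _)).
by rewrite big_seq prodr_ge0 // => z /s01' /andP[].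
Qed.

End RealPart.

(** * Orthogonal projections *)

Section Projection.
Context {R : realType} {k : scalar_kind} {n : nat}.
Local Notation F := (scalar_field R k).
Implicit Types U : {vspace 'rV[F]_n}.

Lemma dotC (u v : 'rV[F]_n) : dot v u = scalar_conj R k (dot u v).
Proof. by rewrite (hermC (@dot R k n) v u) expr0 mul1r. Qed.

Lemma dotZ a b (u v : 'rV[F]_n) :
  dot (a *: u) (b *: v) = a * scalar_conj R k b * dot u v.
Proof. by rewrite linearZl_LR linearZr_LR /= mulrA. Qed.

Lemma proj_orth_uniq U v w :
  w \in U -> {in U, forall y, dot (v - w) y = 0} -> proj_orth U v = w.
Proof.
move=> wU vw; have /andP[pU /mem_orthovP vp] := proj_orthP U v.
apply/eqP; rewrite -subr_eq0.
have dU : proj_orth U v - w \in U by rewrite rpredB.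
have wv : proj_orth U v - w = (v - w) - (v - proj_orth U v).
  by rewrite opprB [RHS]addrC addrA subrK.
have : dot (proj_orth U v - w) (proj_orth U v - w) = 0.
  by rewrite {1}wv linearBl /= vw // vp // subrr.
by move=> d0; apply: contraTT isT => /dot_gt0; rewrite d0 ltxx.
Qed.

Lemma dot_proj_orthl U v w : w \in U -> dot (proj_orth U v) w = dot v w.
Proof.
move=> wU; have /andP[_ /mem_orthovP/(_ w wU)/eqP] := proj_orthP U v.
by rewrite linearBl subr_eq0 => /eqP.
Qed.

(** Pythagoras: v is the orthogonal sum of its projection and the rest. *)
Lemma dot_proj_orth_le U v : dot (proj_orth U v) (proj_orth U v) <= dot v v.
Proof.
have /andP[pU /mem_orthovP vp] := proj_orthP U v.
set p := proj_orth U v in pU vp *.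
have pd : dot p (v - p) = 0 by rewrite dotC vp // rmorph0.
rewrite -{1 2}[v](subrK p); move: (v - p) (vp p pU) pd => d dp pd.
rewrite linearDl !linearDr /= dp pd addr0 add0r.
by rewrite lerDr dot_ge0.
Qed.

Lemma dot_onb U u v : u \in U ->
  dot u v =
  \sum_(i < \dim U) dot u (onb U)`_i * scalar_conj R k (dot v (onb U)`_i).
Proof.
move=> uU; have /andP[bU oU] := onbP U.
have cE (i : 'I_(\dim U)) : coord (onb U) i u = dot u (onb U)`_i.
  rewrite {2}(coord_basis bU uU) linear_sumlz (bigD1 i) //= linearZl_LR /=.
  rewrite onb_dot eqxx mulr1 big1 ?addr0 // => j ji.
  by rewrite linearZl_LR /= onb_dot (negPf ji) mulr0.
rewrite {1}(coord_basis bU uU) linear_sumlz; apply: eq_bigr => i _.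
by rewrite linearZl_LR /= cE -dotC.
Qed.

End Projection.

(** * Projection of wedge products *)

Section ExteriorProjection.
Context {R : realType} {k : scalar_kind} {n : nat}.
Local Notation F := (scalar_field R k).
Implicit Types V W : {vspace 'rV[F]_n}.

(** [ext_sub] sums only the exterior powers of order at most n; the wedge of
more than n vectors vanishes, as no subset of 'I_n indexes a minor. *)
Lemma mem_ext_sub p W (A : 'M[F]_(p, n)) :
  (forall i, row i A \in W) -> wedge A \in ext_sub W.
Proof.
move=> AW; have [pn|np] := leqP p n.
  by rewrite (subvP (sumv_sup (Ordinal (pn : p < n.+1)%N) _ (subvv _))) ?mem_ext_pow.
suff -> : wedge A = 0 by rewrite mem0v.
apply/rowP => l; rewrite !mxE /=; case: eqP => // cI.
by have := max_card (mem (enum_val l)); rewrite cI card_ord leqNgt np.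
Qed.

(** The difference between wedge A and the right-hand side is orthogonal to
every wedge of vectors b_j of W: for the same number of factors, the two Gram
determinants have equal entries <a_i, b_j> = <P a_i, b_j>, and for a different
number both products vanish. *)
Lemma proj_orth_wedge p W (A : 'M[F]_(p, n)) :
  proj_orth (ext_sub W) (wedge A) = wedge (\matrix_i proj_orth W (row i A)).
Proof.
set PA := \matrix_i _.
apply: proj_orth_uniq => [|y].
  by apply: mem_ext_sub => i; rewrite rowK; have /andP[] := proj_orthP W (row i A).
suff /subvP sub : (ext_sub W <= orthov (@dot R k _) <[wedge A - wedge PA]>)%VS.
  by move/sub; rewrite mem_orthov1_sym mem_orthov1 => /eqP.
apply/subv_sumP => r _; apply/span_subvP => _ /mapP[f _ ->].
set B := \matrix_i _; rewrite mem_orthov1_sym mem_orthov1 linearBl subr_eq0 /=.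
have [pr|] := eqVneq p r; last by move=> pr; rewrite !dot_wedge_neq.
subst p; rewrite !dot_wedge; apply/eqP; congr (\det _); apply/matrixP => i j.
by rewrite !mxE !rowK dot_proj_orthl // vbasis_mem // mem_nth // size_tuple.
Qed.

(** * The Gram matrix of the projected basis *)

(** The matrix N^* N of the singular value decomposition; [proj_gramE] shows
that it is the transposed Gram matrix of the projected basis of V. *)
Definition proj_gram V W : 'M[F]_(\dim V) :=
  (proj_mx_onb V W) ^t (scalar_conj R k) *m proj_mx_onb V W.

Lemma proj_gramE V W (i j : 'I_(\dim V)) :
  proj_gram V W i j = dot (proj_orth W (onb V)`_j) (proj_orth W (onb V)`_i).
Proof.
have /andP[PW _] := proj_orthP W (onb V)`_j.
rewrite (dot_onb _ PW) mxE; apply: eq_bigr => l _.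
by rewrite !mxE mulrC.
Qed.

(** The square root of a Gram determinant is the norm of a wedge: this is
||P_W A|| / ||A|| for the nonzero elements A of the line of p-vectors of V,
where p = dim V. *)
Definition wedge_ratio V W : R :=
  Num.sqrt (real_part (\det (proj_gram V W))).

(** The angle may be computed at the wedge of an orthonormal basis of V, which
has norm 1. *)
Lemma asym_angle_det V W : asym_angle V W = acos (wedge_ratio V W).
Proof.
have /andP[bV _] := onbP V.
pose E : 'M[F]_(\dim V, n) := \matrix_i (onb V)`_i.
have E1 : dot (wedge E) (wedge E) = 1.
  rewrite dot_wedge -[RHS](det1 F (\dim V)); congr (\det _).
  by apply/matrixP => i j; rewrite !mxE !rowK onb_dot.
have E0 : wedge E != 0.
  by apply: contra_eq_neq E1 => ->; rewrite linear0r eq_sym oner_eq0.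
have EV : wedge E \in ext_pow (\dim V) V.
  by apply: mem_ext_pow => i; rewrite rowK (basis_mem bV) // mem_nth // size_tuple.
rewrite (asym_angleE W EV E0) /angle_at proj_orth_wedge /vnorm E1 real_part1.
rewrite sqrtr1 divr1 dot_wedge /wedge_ratio -[in RHS]det_tr.
congr (acos (Num.sqrt (real_part (\det _)))).
by apply/matrixP => i j; rewrite [LHS]mxE [RHS]mxE proj_gramE !rowK.
Qed.

(** For an eigenvector v, the vector u with coordinates conj(v_j) in the
orthonormal basis of V satisfies z ||u||^2 = ||P u||^2 <= ||u||^2. *)
Lemma eigenvalues_proj_gram V W :
  {in eigenvalues (proj_gram V W), forall z, 0 <= z <= 1}.
Proof.
move=> z zs.
have : root (char_poly (proj_gram V W)) z.
  by rewrite eigenvaluesP root_prod_XsubC.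
rewrite -eigenvalue_root_char => /eigenvalueP[v vz v0].
(* v is a row vector acting on the left of N^* N, hence the conjugates. *)
pose u := \sum_j scalar_conj R k (v 0 j) *: (onb V)`_j.
have uu : dot u u = dot v v.
  rewrite [RHS]dotE linear_sumlz; apply: eq_bigr => j _.
  rewrite linear_sumr (bigD1 j) //= dotZ onb_dot eqxx mulr1 rmorphK mulrC.
  by rewrite big1 ?addr0 // => l lj; rewrite dotZ onb_dot eq_sym (negPf lj) mulr0.
have zu : z * dot v v = dot (proj_orth W u) (proj_orth W u).
  transitivity (dot (v *m proj_gram V W) v).
    by rewrite vz linearZl_LR.
  rewrite dotE /u linear_sum linear_sumlz; apply: eq_bigr => j _.
  rewrite linear_sumr mxE mulr_suml; apply: eq_bigr => i _.
  rewrite proj_gramE /= ![proj_orth W (_ *: _)]linearZ.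
  by rewrite /= dotZ rmorphK mulrAC [X in X * _]mulrC.
have v1 := dot_gt0 v0.
rewrite -(pmulr_lge0 z v1) zu dot_ge0 /=.
by rewrite -(ler_pM2r v1) zu mul1r -uu dot_proj_orth_le.
Qed.

Lemma size_eigenvalues_proj_gram V W :
  size (eigenvalues (proj_gram V W)) = \dim V.
Proof.
by apply/eq_add_S; rewrite -(size_prod_XsubC _ id) -eigenvaluesP size_char_poly.
Qed.

(** The constant coefficient of the characteristic polynomial. *)
Lemma det_proj_gram V W :
  \det (proj_gram V W) = \prod_(z <- eigenvalues (proj_gram V W)) z.
Proof.
have := char_poly_det (proj_gram V W).
rewrite -horner_coef0 eigenvaluesP horner_prod.
under eq_bigr do rewrite hornerXsubC sub0r -mulN1r.
rewrite big_split /= big_const_seq count_predT iter_mulr_1.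
by rewrite size_eigenvalues_proj_gram => /(can_inj (signrMK _)).
Qed.

(** N^* N factors through the smaller space W. *)
Lemma det_proj_gram_gt V W :
  (\dim W < \dim V)%N -> \det (proj_gram V W) = 0.
Proof.
move=> WV; apply: contraTeq WV; rewrite -unitfE -unitmxE -row_full_unit.
move=> /eqP full; rewrite -leqNgt -[leqLHS]full.
exact: leq_trans (mxrankM_maxr _ _) (rank_leq_row _).
Qed.

Lemma wedge_ratioE V W : wedge_ratio V W =
  \prod_(z <- eigenvalues (proj_gram V W)) Num.sqrt (real_part z).
Proof.
rewrite /wedge_ratio det_proj_gram sqrt_real_part_prod //.
exact: eigenvalues_proj_gram.
Qed.

Lemma sqrt_eigenvalue_itv01 V W z : z \in eigenvalues (proj_gram V W) ->
  0 <= Num.sqrt (real_part z) <= 1.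
Proof.
move=> /eigenvalues_proj_gram/real_part_itv01/andP[z0 z1].
by rewrite sqrtr_ge0 -[leRHS]sqrtr1 ler_wsqrtr.
Qed.

Lemma wedge_ratio_itv01 V W : 0 <= wedge_ratio V W <= 1.
Proof.
rewrite {2}wedge_ratioE sqrtr_ge0 big_seq prodr_ile1 // => z.
exact: sqrt_eigenvalue_itv01.
Qed.

Lemma wedge_ratio_dim0 V W : \dim V = 0%N -> wedge_ratio V W = 1.
Proof.
move=> V0; rewrite /wedge_ratio; move: (proj_gram V W); rewrite V0 => G.
by rewrite det_mx00 real_part1 sqrtr1.
Qed.

Lemma wedge_ratio_gt V W : (\dim W < \dim V)%N -> wedge_ratio V W = 0.
Proof.
by move=> WV; rewrite /wedge_ratio det_proj_gram_gt // real_part0 sqrtr0.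
Qed.

(** When dim V <= dim W, [singular_values] keeps all the dim V eigenvalues, and
cos undoes acos because their square roots lie in [0, 1]. *)
Lemma prod_cos_principal_angles V W : (\dim V <= \dim W)%N ->
  \prod_(i < \dim V) cos (principal_angles V W)`_i = wedge_ratio V W.
Proof.
move=> VW; rewrite /principal_angles /singular_values -/(proj_gram V W).
rewrite (minn_idPl VW); set sv := sort _ _.
have size_sv : size sv = \dim V.
  by rewrite size_sort size_map size_eigenvalues_proj_gram.
rewrite -[X in take X]size_sv take_size wedge_ratioE.
transitivity (\prod_(s <- sv) cos (acos s)).
  by rewrite -(big_map acos xpredT cos) (big_nth 0) big_mkord size_map size_sv.
have sv_perm : perm_eq sv
    [seq Num.sqrt (real_part z) | z <- eigenvalues (proj_gram V W)].
  by rewrite /sv perm_sort.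
rewrite (perm_big _ sv_perm) big_map; apply: eq_big_seq => z.
move=> /sqrt_eigenvalue_itv01/andP[z0 z1].
by rewrite acosK // in_itv /= z1 andbT (le_trans _ z0) // lerN10.
Qed.

End ExteriorProjection.

(** * The chord of an angle *)

(** The half-angle formula 1 - cos theta = 2 sin^2 (theta / 2). *)
Lemma sqrt_chord_acos (R : realType) (c : R) : -1 <= c <= 1 ->
  Num.sqrt (2 - 2 * c) = 2 * sin (acos c / 2).
Proof.
move=> c1; set t := acos c / 2.
have ct : c = 1 - sin t ^+ 2 *+ 2.
  rewrite -{1}(@acosK R c) ?in_itv //.
  have -> : acos c = t *+ 2 by rewrite /t -mulr_natr divfK // pnatr_eq0.
  by rewrite cos_mulr2n cos2sin2 mulrnBl addrAC [1 *+ 2]mulr2n addrK.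
have t_ge0 : 0 <= sin t.
  rewrite sin_ge0_pi // /t divr_ge0 ?acos_ge0 //=.
  rewrite ler_pdivrMr // (le_trans (acos_lepi c1)) // ler_peMr ?pi_ge0 //.
  by rewrite ler1n.
rewrite {1}ct mulrBr mulr1 opprB addrC subrK.
have -> : 2 * (sin t ^+ 2 *+ 2) = (2 * sin t) ^+ 2.
  by rewrite -[_ ^+ 2 *+ 2]mulr_natl mulrA -expr2 exprMn.
by rewrite sqrtr_sqr ger0_norm // mulr_ge0.
Qed.

(** * The metrics in terms of the asymmetric angle *)

Theorem proposition5p1 (R : realType) (k : scalar_kind) (n : nat)
    (V W : {vspace 'rV[scalar_field R k]_n}) :
  [/\ d_FS V W = asym_angle V W,
      d_chordal_wedge V W = 2 * sin (asym_angle V W / 2)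
    & d_BC V W = sin (asym_angle V W)].
Proof.
have /andP[c0 c1] := wedge_ratio_itv01 V W.
have cN1 : -1 <= wedge_ratio V W <= 1 by rewrite c1 (le_trans _ c0) ?lerN10.
rewrite asym_angle_det -sqrt_chord_acos // sin_acos //.
rewrite /d_FS /d_chordal_wedge /d_BC.
have [V0|V0] := eqVneq (\dim V) 0.
  by rewrite wedge_ratio_dim0 // acos1 mulr1 expr1n !subrr sqrtr0.
case: leqP => VW; last first.
  by rewrite wedge_ratio_gt // acos0 mulr0 expr0n !subr0 sqrtr1.
by rewrite prodrXl prod_cos_principal_angles.
Qed.
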